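(* Let $\mathcal X$ be a countable collection of points of $\mathbb{R}^d$, let $F$ be a (discrete) probability distribution on $\mathcal X$ with probabilities $p(x)>0$, $x\in\mathcal X$, and let $G\neq F$ be another probability distribution on $\mathcal X$ with probabilities $\pi(x)$, $x\in\mathcal X$. For $x\in\mathcal X$ let $l(x)=\sqrt{\pi(x)/p(x)}$. If $v_F$ is an $F$-Brownian bridge (on $\mathcal X$), then the process $$v_G(B)=\int_{y\in B\cap\mathcal X}l(y)\,v_F(\mathrm{d}y)-\int_{y\in\mathcal X}l(y)\,v_F(\mathrm{d}y)\;\frac{1}{1-\int_{y\in\mathcal X}l(y)\,\mathrm{d}F(y)}\int_{y\in B\cap\mathcal X}\bigl(\mathrm{d}G(y)-l(y)\,\mathrm{d}F(y)\bigr),$$ indexed by Borel sets $B\subset\mathbb{R}^d$, is a $G$-Brownian bridge.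
   Context: For a probability distribution $F$ on $\mathbb{R}^d$, write $\langle\phi,\tilde\phi\rangle_F=\int\phi\tilde\phi\,\mathrm{d}F$ and let $q_0$ be the function identically equal to $1$. An $F$-Brownian motion $w_F$ is a family of centered jointly Gaussian random variables $w_F(\phi)$, $\phi\in L_2(F)$, (a.s.) linear in $\phi$, with $E\,w_F(\phi)w_F(\tilde\phi)=\langle\phi,\tilde\phi\rangle_F$. An $F$-Brownian bridge is a family distributed as $v_F(\phi)=w_F(\phi)-\langle\phi,q_0\rangle_F w_F(q_0)$, $\phi\in L_2(F)$. One writes $\int\phi(y)\,v_F(\mathrm{d}y)=v_F(\phi)$, $\int_{y\in B}\phi(y)\,v_F(\mathrm{d}y)=v_F(\phi\mathbf 1_B)$. In set-parametric form $v_F(B)=v_F(\mathbf 1_B)$, and an $F$-Brownian bridge indexed by sets is a centered Gaussian process with covariance $F(B\cap B')-F(B)F(B')$. For discrete $F$ on $\mathcal X$, $v_F(\mathrm{d}x)$ is the jump of $v_F$ at $x\in\mathcal X$ and is $0$ elsewhere; integrals with respect to $F$ and $G$ are sums over $\mathcal X$. *)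

(* Defs.v *)
From HB Require Import structures.
From mathcomp Require Import all_boot all_order all_algebra.
From mathcomp Require Import all_classical all_reals all_analysis.

Set Implicit Arguments.
Unset Strict Implicit.
Unset Printing Implicit Defensive.

Import Order.TTheory GRing.Theory Num.Theory.
Import numFieldNormedType.Exports.

Local Open Scope classical_set_scope.
Local Open Scope ring_scope.

(* The sigma-algebra generated by the open sets of R^d. *)
Definition borelRd (R : realType) (d : nat) :=
  g_sigma_algebraType (@open 'rV[R]_d).

Section gaussian.
Context {R : realType} {disp : measure_display} {T : measurableType disp}.
Variable P : probability T R.

(* Constants count as Gaussian; [normal_prob m 0] is not a point mass, so the
   degenerate case is handled by a Dirac measure. *)
Definition gaussian (X : T -> R) : Prop :=
  measurable_fun setT X /\
  exists m s : R, forall A : set R, measurable A ->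
    pushforward P X A = if s == 0 then dirac m A else normal_prob m s A.

Definition jointly_gaussian (I : Type) (D : set I) (Z : I -> T -> R) : Prop :=
  forall (n : nat) (i : 'I_n -> I) (a : 'I_n -> R),
    (forall k, D (i k)) -> gaussian (fun t => \sum_(k < n) a k * Z (i k) t).

Record centered_gaussian_process (I : Type) (D : set I) (Z : I -> T -> R) :
    Prop := CenteredGaussianProcess {
  cgp_measurable : forall i, D i -> measurable_fun setT (Z i) ;
  cgp_gaussian : jointly_gaussian D Z ;
  cgp_centered : forall i, D i -> ('E_P[Z i] = 0)%E }.

End gaussian.

Section brownian.
Context {R : realType} {dispE : measure_display} {E : measurableType dispE}.
Variable F : probability E R.

Definition inner (phi psi : E -> R) : R := \int[F]_x (phi x * psi x).

(* The square-integrable functions themselves, not their a.e. classes. *)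
Definition L2 : set (E -> R) := [set phi | phi \in Lfun F 2%:E].

Definition q0 : E -> R := cst 1.

(* Families indexed by L2 are given as total functions on E -> R; their values
   outside L2 are irrelevant. *)
Record brownian_motion {disp : measure_display} {T : measurableType disp}
    (P : probability T R) (w : (E -> R) -> T -> R) : Prop := BrownianMotion {
  bm_gaussian : centered_gaussian_process P L2 w ;
  bm_linear : forall (a b : R) (phi psi : E -> R), L2 phi -> L2 psi ->
    {ae P, forall t, w (fun x => a * phi x + b * psi x) t
                     = a * w phi t + b * w psi t} ;
  bm_cov : forall phi psi : E -> R, L2 phi -> L2 psi ->
    'E_P[w phi \* w psi]%E = (inner phi psi)%:E }.

Definition same_fdd {disp1 : measure_display} {T1 : measurableType disp1}
    {disp2 : measure_display} {T2 : measurableType disp2}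
    (P1 : probability T1 R) (P2 : probability T2 R) (I : Type) (D : set I)
    (Y : I -> T1 -> R) (Z : I -> T2 -> R) : Prop :=
  forall (n : nat) (i : 'I_n -> I), (forall k, D (i k)) ->
    forall A : set (n.-tuple R), measurable A ->
      pushforward P1 (fun t => [tuple Y (i k) t | k < n]) A =
      pushforward P2 (fun t => [tuple Z (i k) t | k < n]) A.

Definition brownian_bridge {disp : measure_display} {T : measurableType disp}
    (P : probability T R) (v : (E -> R) -> T -> R) : Prop :=
  (forall phi, L2 phi -> measurable_fun setT (v phi)) /\
  exists (disp' : measure_display) (T' : measurableType disp')
         (P' : probability T' R) (w : (E -> R) -> T' -> R),
    brownian_motion P' w /\
    same_fdd P P' L2 v (fun phi t => w phi t - inner phi q0 * w q0 t).

Record set_brownian_bridge {disp : measure_display} {T : measurableType disp}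
    (P : probability T R) (v : set E -> T -> R) : Prop := SetBrownianBridge {
  sbb_gaussian : centered_gaussian_process P measurable v ;
  sbb_cov : forall B B' : set E, measurable B -> measurable B' ->
    covariance P (v B) (v B') = (F (B `&` B') - F B * F B')%E }.

(* The integral over B of phi(y) v(dy), by definition v(phi 1_B). *)
Definition bridge_integral {T : Type} (v : (E -> R) -> T -> R) (B : set E)
    (phi : E -> R) : T -> R :=
  v (fun y => phi y * \1_B y).

End brownian.

(* Main.v *)
Require Import Defs.
From HB Require Import structures.
From mathcomp Require Import all_boot all_order all_algebra.
From mathcomp Require Import all_classical all_reals all_analysis.
From mathcomp Require Import ring measurable_realfun.

Set Implicit Arguments.
Unset Strict Implicit.
Unset Printing Implicit Defensive.

Import Order.TTheory GRing.Theory Num.Theory.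
Import numFieldNormedType.Exports.

Local Open Scope classical_set_scope.
Local Open Scope ring_scope.

(** Write [l] for the square root of the density of [G] with respect to [F], so
    that [G = l ^ 2 F], and put [m = int l dF]. Every value of the process [v_G]
    is a fixed linear combination of two values of the bridge,
      [v_G B = v (l 1_B) - c B * v l],
      [c B = (G B - int_B l dF) / (1 - m)].
    Hence [v_G] inherits from [v] joint Gaussianity and zero mean, and only the
    covariance has to be computed. As [v] has the covariance
    [<phi, psi> - <phi, 1> <psi, 1>], as [<l 1_B, l 1_B'> = G (B `&` B')], and
    as [<l 1_B, 1> = int_B l dF =: m B], bilinearity gives
      [G (B `&` B') - m B m B' - c B' (G B - m B m) - c B (G B' - m m B')
       + c B c B' (1 - m ^ 2)].
    Substituting [G B = m B + c B (1 - m)], and the same for [B'], reduces this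
    to [G (B `&` B') - G B * G B'] (theorem [bridge_change_of_measure]).

    The division by [1 - m] makes sense because [F] and [G] differ: [l] has
    second moment [G setT = 1] under [F], so if its mean were [1] its variance
    would vanish, [l] would be [1] almost everywhere and [G] would equal [F]
    ([root_density_mean_neq1]).

    This argument does not see the atoms; it works on any measurable space on
    which [G] has a density with respect to [F]. In the discrete case countable
    additivity shows that [pi / p] is such a density ([discrete_density]).

    A bridge is specified only by its law, through a Brownian motion on another
    probability space. So its Gaussianity and its first two moments are computed
    for that Brownian motion and carried over along the equality of the
    finite-dimensional distributions. *)

(** * Square-integrable functions and covariances *)

Section square_integrable.
Context {R : realType} {d : measure_display} {T : measurableType d}.
Variable mu : probability T R.

Lemma Lfun2P (f : T -> R) :
  f \in Lfun mu 2%:E <->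
  measurable_fun setT f /\ (\int[mu]_x (f x * f x)%:E < +oo)%E.
Proof.
have powE x : `|f x| `^ 2 = f x * f x.
  by rewrite powR_mulrn// -normrX ger0_norm ?sqr_ge0// expr2.
split=> [f2|[mf f2]].
  split; first by move/sub_Lfun_mfun : f2; rewrite inE.
  by have /Lfun2_integrable_sqr/(integrable_lty measurableT) := f2.
apply/andP; split; first by rewrite inE.
rewrite inE/= /finite_norm unlock/= poweR_lty//.
by under eq_integral do rewrite /= powE.
Qed.

Lemma Lfun2_measurable (f : T -> R) :
  f \in Lfun mu 2%:E -> measurable_fun setT f.
Proof. by move=> /Lfun2P[]. Qed.

Lemma Lfun2_Lfun1 (f : T -> R) : f \in Lfun mu 2%:E -> f \in Lfun mu 1%E.
Proof. by apply: Lfun_subset12; exact: fin_num_measure. Qed.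

Lemma Lfun2_subZ (f g : T -> R) (c : R) :
  f \in Lfun mu 2%:E -> g \in Lfun mu 2%:E ->
  (fun x => f x - c * g x) \in Lfun mu 2%:E.
Proof.
move=> f2 g2.
have cg2 := Lfun_scale c (ler1n R 2) g2.
have -> : (fun x => f x - c * g x) = f \- c \o* g.
  by apply/funext => x /=; rewrite mulrC.
have [_ closed] := Lfun_submod_closed mu (lee1n 2).
have -> : f \- c \o* g = (-1) *: (c \o* g) + f.
  by apply/funext => x; rewrite !fctE /= scaleN1r addrC.
exact: closed.
Qed.

Lemma expectation_subZ (f g : T -> R) (c : R) :
  f \in Lfun mu 1%E -> g \in Lfun mu 1%E ->
  ('E_mu[fun x => (f x - c * g x)%R] = 'E_mu[f] - c%:E * 'E_mu[g])%E.
Proof.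
move=> f1 g1.
have -> : (fun x => f x - c * g x) = f \- c \o* g.
  by apply/funext => x /=; rewrite mulrC.
have cg1 : c \o* g \in Lfun mu 1%E by apply: (Lfun_scale c (lexx 1)).
by rewrite expectationB// expectationZl.
Qed.

(** Both the bridge built from a Brownian motion and the set-indexed process
    built from a bridge have values of the form [f - c g], so this one expansion
    gives the covariance of each. *)
Lemma covariance_subZ (f g f' g' : T -> R) (c c' : R) :
  f \in Lfun mu 2%:E -> g \in Lfun mu 2%:E ->
  f' \in Lfun mu 2%:E -> g' \in Lfun mu 2%:E ->
  (covariance mu (fun x => f x - c * g x)%R (fun x => f' x - c' * g' x)%R =
   covariance mu f f' - c'%:E * covariance mu f g'
   - c%:E * (covariance mu g f' - c'%:E * covariance mu g g'))%E.
Proof.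
move=> f2 g2 f'2 g'2.
have E c0 (a b : T -> R) : (fun x => a x - c0 * b x) = a \- c0 \o* b.
  by apply/funext => x /=; rewrite mulrC.
have cg2 := Lfun_scale c (ler1n R 2) g2.
have cg'2 := Lfun_scale c' (ler1n R 2) g'2.
have B2 : f' \- c' \o* g' \in Lfun mu 2%:E by rewrite -E Lfun2_subZ.
rewrite !E covarianceBl// !covarianceBr//.
have mul1 (a b : T -> R) : a \in Lfun mu 2%:E -> b \in Lfun mu 2%:E ->
  (a * b)%R \in Lfun mu 1%E by exact: Lfun2_mul_Lfun1.
have fin (a b : T -> R) : a \in Lfun mu 2%:E -> b \in Lfun mu 2%:E ->
    covariance mu a b \is a fin_num.
  move=> a2 b2; apply: covariance_fin_num; last exact: mul1.
    exact: Lfun2_Lfun1.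
  exact: Lfun2_Lfun1.
rewrite !covarianceZr ?covarianceZl//; do ?[exact: mul1|exact: Lfun2_Lfun1].
rewrite -(fineK (fin _ _ f2 f'2)) -(fineK (fin _ _ f2 g'2)).
rewrite -(fineK (fin _ _ g2 f'2)) -(fineK (fin _ _ g2 g'2)).
by congr EFin; rewrite mulrBr [in RHS]mulrCA.
Qed.

End square_integrable.

(** * Transfer along equality of finite-dimensional distributions *)

Section transfer.
Context {R : realType}.
Context {d1 : measure_display} {T1 : measurableType d1}.
Context {d2 : measure_display} {T2 : measurableType d2}.
Variables (P1 : probability T1 R) (P2 : probability T2 R).

Definition same_law (X : T1 -> R) (Y : T2 -> R) :=
  forall A : set R, measurable A -> pushforward P1 X A = pushforward P2 Y A.

Lemma same_law_ge0_integral (X : T1 -> R) (Y : T2 -> R) (f : R -> \bar R) :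
  measurable_fun setT X -> measurable_fun setT Y -> same_law X Y ->
  measurable_fun setT f -> (forall x, 0 <= f x)%E ->
  (\int[P1]_t f (X t) = \int[P2]_t f (Y t))%E.
Proof.
move=> mX mY XY mf f0.
have := ge0_integral_pushforward mX P1 measurableT mf (fun x _ => f0 x).
rewrite preimage_setT => <-.
have := ge0_integral_pushforward mY P2 measurableT mf (fun x _ => f0 x).
rewrite preimage_setT => <-.
by apply: eq_measure_integral => A mA _; exact: XY.
Qed.

(** An expectation is the difference of the integrals of the positive and the
    negative part, and the law determines each of these. *)
Lemma same_law_expectation (X : T1 -> R) (Y : T2 -> R) :
  measurable_fun setT X -> measurable_fun setT Y -> same_law X Y ->
  ('E_P1[X] = 'E_P2[Y])%E.
Proof.
move=> mX mY XY; rewrite unlock integralE [RHS]integralE.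
have mE : measurable_fun setT (@EFin R) by exact/measurable_EFinP.
congr (_ - _)%E.
- rewrite (funepos_comp (@EFin R) X) (funepos_comp (@EFin R) Y).
  exact: (same_law_ge0_integral mX mY XY (measurable_funepos mE)
    (funepos_ge0 _)).
- rewrite (funeneg_comp (@EFin R) X) (funeneg_comp (@EFin R) Y).
  exact: (same_law_ge0_integral mX mY XY (measurable_funeneg mE)
    (funeneg_ge0 _)).
Qed.

Lemma same_law_gaussian (X : T1 -> R) (Y : T2 -> R) :
  measurable_fun setT X -> same_law X Y -> gaussian P2 Y -> gaussian P1 X.
Proof.
move=> mX XY [_ [m [s law]]]; split => //.
by exists m, s => A mA; rewrite XY// law.
Qed.

Context {I : Type} {D : set I} {Y : I -> T1 -> R} {Z : I -> T2 -> R}.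
Hypothesis YZ : same_fdd P1 P2 D Y Z.
Hypothesis mY : forall i, D i -> measurable_fun setT (Y i).
Hypothesis mZ : forall i, D i -> measurable_fun setT (Z i).

(** All the transfers below are instances of this one, for [g] a coordinate, a
    product of two coordinates or a linear combination of coordinates. *)
Lemma same_fdd_comp n (i : 'I_n -> I) (g : n.-tuple R -> R) :
  (forall k, D (i k)) -> measurable_fun setT g ->
  same_law (fun t => g [tuple Y (i k) t | k < n])
           (fun t => g [tuple Z (i k) t | k < n]).
Proof.
move=> Di mg A mA; apply: (YZ Di (A := g @^-1` A)).
by rewrite -[X in measurable X]setTI; exact: mg.
Qed.

Lemma same_fdd_expectation i : D i -> ('E_P1[Y i] = 'E_P2[Z i])%E.
Proof.
move=> Di; apply: same_law_expectation; [exact: mY|exact: mZ|].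
have := @same_fdd_comp 1 (fun=> i) (fun u => tnth u ord0) (fun=> Di).
move=> /(_ (measurable_tnth _)) law A mA; have := law A mA.
by rewrite /pushforward /=; under eq_fun do rewrite tnth_mktuple;
  under [in RHS]eq_fun do rewrite tnth_mktuple.
Qed.

Lemma same_fdd_expectation_mul i j : D i -> D j ->
  ('E_P1[Y i \* Y j] = 'E_P2[Z i \* Z j])%E.
Proof.
move=> Di Dj; apply: same_law_expectation;
  [by apply: measurable_funM; exact: mY|by apply: measurable_funM; exact: mZ|].
pose ij (k : 'I_2) := if k == ord0 then i else j.
have Dij k : D (ij k) by rewrite /ij; case: ifP.
have mg : measurable_fun setT
    (fun u : 2.-tuple R => tnth u ord0 * tnth u ord_max).
  by apply: measurable_funM; exact: measurable_tnth.
move=> A mA; have := same_fdd_comp Dij mg mA.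
by rewrite /pushforward /=; under eq_fun do rewrite !tnth_mktuple;
  under [in RHS]eq_fun do rewrite !tnth_mktuple.
Qed.

Lemma same_fdd_jointly_gaussian :
  jointly_gaussian P2 D Z -> jointly_gaussian P1 D Y.
Proof.
move=> gZ n i a Di.
have mg : measurable_fun setT
    (fun u : n.-tuple R => \sum_(k < n) a k * tnth u k).
  apply: measurable_sum => k; apply: measurable_funM => //.
  exact: measurable_tnth.
apply: same_law_gaussian (gZ n i a Di).
  by apply: measurable_sum => k; apply: measurable_funM => //; exact: mY.
have sumE (T : Type) (f : 'I_n -> T -> R) :
    (fun t => \sum_(k < n) a k * tnth [tuple f j t | j < n] k) =
    (fun t => \sum_(k < n) a k * f k t).
  by apply/funext => t; apply: eq_bigr => k _; rewrite tnth_mktuple.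
by move=> A mA; have := same_fdd_comp Di mg mA; rewrite /= !sumE.
Qed.

End transfer.

(** * Gaussianity and moments of Brownian bridges *)

(** A linear combination of the new variables is one of the old variables: the
    coefficients of [Z j0] add up to minus the sum of the [a m * c (i m)], and
    [Z j0] is listed first, at index [ord0]. *)
Lemma jointly_gaussian_subZ {R : realType} {d : measure_display}
    {T : measurableType d} (P : probability T R) (I J : Type)
    (D : set I) (D' : set J) (Z : I -> T -> R) (f : J -> I) (j0 : I)
    (c : J -> R) :
  D j0 -> (forall j, D' j -> D (f j)) -> jointly_gaussian P D Z ->
  jointly_gaussian P D' (fun j t => Z (f j) t - c j * Z j0 t).
Proof.
move=> Dj0 D'D gZ n i a D'i.
pose i1 (k : 'I_n.+1) := if unlift ord0 k is Some k' then f (i k') else j0.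
(* The coefficient is made opaque so that rewriting under the outer sum cannot
   reach this inner one. *)
have [s sE] : exists s, s = \sum_(m < n) a m * c (i m) by eexists.
pose a1 (k : 'I_n.+1) :=
  if unlift ord0 k is Some k' then a k' else - s.
have Di1 k : D (i1 k) by rewrite /i1; case: unliftP => // k' _; exact: D'D.
have := gZ _ i1 a1 Di1; congr (gaussian P _); apply/funext => t.
rewrite big_ord_recl /i1 /a1 unlift_none.
under eq_bigr do rewrite liftK.
under [RHS]eq_bigr do rewrite mulrBr mulrA.
by rewrite sumrB -mulr_suml -sE mulNr addrC.
Qed.

Section bridge.
Context {R : realType} {dE : measure_display} {E : measurableType dE}.
Variable F : probability E R.

Lemma L2_q0 : L2 F q0.
Proof. exact: Lfun_cst. Qed.

Lemma inner_q0 : inner F q0 q0 = 1.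
Proof.
rewrite /inner (@eq_Rintegral _ _ _ _ _ (cst 1)) => [|x _]; last first.
  by rewrite /q0/= mulr1.
by rewrite Rintegral_cst//= probability_setT mulr1.
Qed.

Lemma innerC phi psi : inner F phi psi = inner F psi phi.
Proof. by apply: eq_Rintegral => x _; rewrite mulrC. Qed.

Section motion.
Context {d : measure_display} {T : measurableType d} {P : probability T R}.
Context {w : (E -> R) -> T -> R}.
Hypothesis bw : brownian_motion F P w.

Lemma brownian_motion_Lfun2 phi : L2 F phi -> w phi \in Lfun P 2%:E.
Proof.
move=> L2phi; apply/Lfun2P; split.
  exact: cgp_measurable (bm_gaussian bw) _ L2phi.
by have := bm_cov bw L2phi L2phi; rewrite unlock => ->; exact: ltry.
Qed.

Lemma brownian_motion_covariance phi psi : L2 F phi -> L2 F psi ->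
  covariance P (w phi) (w psi) = (inner F phi psi)%:E.
Proof.
move=> L2phi L2psi.
have w2 := brownian_motion_Lfun2 L2phi; have w2' := brownian_motion_Lfun2 L2psi.
rewrite covarianceE; [|exact: Lfun2_Lfun1|exact: Lfun2_Lfun1|].
  rewrite (cgp_centered (bm_gaussian bw) L2phi) mul0e sube0.
  exact: (bm_cov bw L2phi L2psi).
exact: Lfun2_mul_Lfun1.
Qed.

End motion.

Section bridge_moments.
Context {d : measure_display} {T : measurableType d} {P : probability T R}.
Context {v : (E -> R) -> T -> R}.
Hypothesis bv : brownian_bridge F P v.

Lemma brownian_bridge_gaussian : centered_gaussian_process P (L2 F) v.
Proof.
have [mv [d' [T' [P' [w [bw law]]]]]] := bv.
have gw := bm_gaussian bw.
have w2 := brownian_motion_Lfun2 bw.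
have mW phi : L2 F phi ->
    measurable_fun setT (fun t => w phi t - inner F phi q0 * w q0 t).
  by move=> phi2; apply/Lfun2_measurable/Lfun2_subZ; apply: w2 => //;
    exact: L2_q0.
split => //.
  apply: (same_fdd_jointly_gaussian law mv).
  exact: (jointly_gaussian_subZ (f := id) (fun phi => inner F phi q0)
    L2_q0 (fun=> id) (cgp_gaussian gw)).
move=> phi phi2; rewrite (same_fdd_expectation law mv mW phi2).
rewrite expectation_subZ; [|exact/Lfun2_Lfun1/w2|exact/Lfun2_Lfun1/w2/L2_q0].
by rewrite !(cgp_centered gw)// ?mule0 ?sube0//; exact: L2_q0.
Qed.

(** The second moment is part of the law of the pair [(v phi, v phi)], hence
    equals that of the bridge built from a Brownian motion. *)
Lemma brownian_bridge_Lfun2 phi : L2 F phi -> v phi \in Lfun P 2%:E.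
Proof.
move=> phi2; have [mv [d' [T' [P' [w [bw law]]]]]] := bv.
have W2 psi : L2 F psi ->
    (fun t => w psi t - inner F psi q0 * w q0 t) \in Lfun P' 2%:E.
  by move=> psi2; apply: Lfun2_subZ; apply: (brownian_motion_Lfun2 bw) => //;
    exact: L2_q0.
have mW psi psi2 := Lfun2_measurable (W2 psi psi2).
apply/Lfun2P; split; first exact: mv.
have := same_fdd_expectation_mul law mv mW phi2 phi2.
rewrite unlock => ->.
by have /Lfun2P[] := W2 _ phi2.
Qed.

Lemma brownian_bridge_covariance phi psi : L2 F phi -> L2 F psi ->
  covariance P (v phi) (v psi) =
    (inner F phi psi - inner F phi q0 * inner F psi q0)%:E.
Proof.
move=> phi2 psi2; have [mv [d' [T' [P' [w [bw law]]]]]] := bv.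
have w2 := brownian_motion_Lfun2 bw.
pose W f t := w f t - inner F f q0 * w q0 t.
have W2 f : L2 F f -> W f \in Lfun P' 2%:E.
  by move=> f2; apply/Lfun2_subZ; apply: w2 => //; exact: L2_q0.
have mW f f2 := Lfun2_measurable (W2 f f2).
have Ev := cgp_centered brownian_bridge_gaussian.
have EW f : L2 F f -> ('E_P'[W f] = 0)%E.
  by move=> f2; rewrite -(same_fdd_expectation law mv mW f2) Ev.
(* Both means vanish, so the covariances are expectations of products. *)
transitivity (covariance P' (W phi) (W psi)).
  have v2 := brownian_bridge_Lfun2.
  rewrite !covarianceE; do ?[exact/Lfun2_Lfun1/W2|exact/Lfun2_Lfun1/v2].
  - rewrite Ev// EW// !mul0e !sube0.
    exact: (same_fdd_expectation_mul law mv mW phi2 psi2).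
  - by apply: Lfun2_mul_Lfun1; exact: W2.
  - by apply: Lfun2_mul_Lfun1; exact: v2.
rewrite covariance_subZ; do ?[apply: w2 => //; exact: L2_q0].
rewrite !(brownian_motion_covariance bw)//; do ?[exact: L2_q0].
rewrite inner_q0 (innerC q0 psi) -?EFinM -?EFinB; congr EFin.
by rewrite mulr1 subrr mulr0 subr0 [X in _ - X]mulrC.
Qed.

End bridge_moments.
End bridge.

(** * Change of measure by the root of a density *)

Section change_of_measure.
Context {R : realType} {dE : measure_display} {E : measurableType dE}.
Variables (F G : probability E R) (l : E -> R).
Hypothesis ml : measurable_fun setT l.
Hypothesis density :
  forall B, measurable B -> G B = (\int[F]_(x in B) (l x ^+ 2)%:E)%E.

Lemma root_density_Lfun2 : l \in Lfun F 2%:E.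
Proof.
apply/Lfun2P; split => //.
under eq_integral do rewrite -expr2.
by rewrite -density// probability_setT ltry.
Qed.

Lemma L2_root_density_restr B : measurable B -> L2 F (fun y => l y * \1_B y).
Proof.
move=> mB; apply/Lfun2P.
have mlB : measurable_fun setT (fun y => l y * \1_B y).
  by apply: measurable_funM.
split => //.
have /Lfun2P[_] := root_density_Lfun2; apply: le_lt_trans.
apply: ge0_le_integral => //.
- by move=> x _; rewrite lee_fin -expr2 sqr_ge0.
- by apply/measurable_EFinP; exact: measurable_funM.
- by apply/measurable_EFinP; exact: measurable_funM.
move=> x _; rewrite lee_fin indicE.
by case: (x \in B); rewrite ?mulr1// mulr0 mul0r -expr2 sqr_ge0.
Qed.

Lemma inner_root_density B B' : measurable B -> measurable B' ->
  inner F (fun y => l y * \1_B y) (fun y => l y * \1_B' y) =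
  fine (G (B `&` B')).
Proof.
move=> mB mB'; rewrite density; last exact: measurableI.
rewrite -[RHS]/(\int[F]_(x in B `&` B') (l x ^+ 2)) Rintegral_mkcond.
apply: eq_Rintegral => x _.
rewrite patchE in_setI !indicE expr2.
by case: (x \in B); case: (x \in B'); rewrite ?(mulr1, mulr0, mul0r).
Qed.

Lemma inner_root_density_q0 B :
  inner F (fun y => l y * \1_B y) q0 = \int[F]_(x in B) l x.
Proof.
rewrite [RHS]Rintegral_mkcond; apply: eq_Rintegral => x _.
by rewrite patchE indicE /q0/= mulr1; case: (x \in B); rewrite ?mulr1 ?mulr0.
Qed.

(** Under [F] the second moment of [l] is [G setT = 1], so a mean equal to [1]
    forces zero variance, hence [l = 1] almost everywhere and [G = F]. *)
Lemma root_density_mean_neq1 :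
  (exists2 B, measurable B & G B <> F B) -> \int[F]_x l x != 1.
Proof.
move=> [B mB GFB]; apply/eqP => l1; apply: GFB.
have l2 := root_density_Lfun2; have lint := Lfun2_Lfun1 l2.
have El : ('E_F[l] = 1)%E.
  rewrite -(fineK (expectation_fin_num lint)) unlock.
  by rewrite -[fine _]/(\int[F]_x l x) l1.
have var0 : (\int[F]_x ((l x - 1) ^+ 2)%:E = 0)%E.
  have Ell : ('E_F[l * l] = 1)%E.
    by rewrite unlock -(probability_setT G) density.
  have := covarianceE lint lint (Lfun2_mul_Lfun1 l2 l2).
  rewrite Ell El mule1 subee// => <-; rewrite unlock El unlock.
  by apply: eq_integral => x _; rewrite expr2.
have l1ae : ae_eq F setT (fun x => ((l x - 1) ^+ 2)%:E) (cst 0%E).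
  apply/ae_eq_integral_abs => //.
    by apply/measurable_EFinP/measurable_funX/measurable_funB.
  by rewrite -[RHS]var0; apply: eq_integral => x _;
    rewrite gee0_abs ?lee_fin ?sqr_ge0.
rewrite density//.
transitivity (\int[F]_(x in B) (cst 1%E x))%E; last first.
  by rewrite integral_cst// mul1e.
apply: ae_eq_integral => //.
  by apply/measurable_EFinP/measurable_funX/measurable_funTS.
apply: filterS l1ae => x /(_ Logic.I) [] /eqP + _.
by rewrite sqrf_eq0 subr_eq0 => /eqP ->; rewrite expr1n.
Qed.

Context {d : measure_display} {T : measurableType d} {P : probability T R}.
Context {v : (E -> R) -> T -> R}.

(** The integral of [l ^+ 2] over [B] is [G B] when [B] is measurable. It is
    written as an integral so that, for a density carried by a set [X], it is
    also for a non-measurable [B] the integral over [B `&` X]; the processes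
    then agree as functions of an arbitrary set. *)
Theorem bridge_change_of_measure :
  (exists2 B, measurable B & G B <> F B) -> brownian_bridge F P v ->
  set_brownian_bridge G P (fun B t =>
    bridge_integral v B l t
    - bridge_integral v setT l t * (1 / (1 - \int[F]_x l x))
      * (\int[F]_(x in B) (l x ^+ 2) - \int[F]_(x in B) l x)).
Proof.
move=> GF bv.
have m1 := root_density_mean_neq1 GF.
set m := \int[F]_x l x in m1 *.
pose phi B := fun y => l y * \1_B y.
pose c B := 1 / (1 - m) * (\int[F]_(x in B) (l x ^+ 2) - \int[F]_(x in B) l x).
have phi2 B : measurable B -> L2 F (phi B) by exact: L2_root_density_restr.
have gv := brownian_bridge_gaussian bv.
have v2 B : measurable B -> v (phi B) \in Lfun P 2%:E.
  by move=> mB; apply: (brownian_bridge_Lfun2 bv); exact: phi2.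
rewrite (_ : (fun B t => _) =
    fun B t => v (phi B) t - c B * v (phi setT) t); last first.
  apply/funext => B; apply/funext => t.
  by rewrite /bridge_integral -/(phi B) -/(phi setT) -mulrA [X in _ - X]mulrC.
have Z2 B : measurable B ->
    (fun t => v (phi B) t - c B * v (phi setT) t) \in Lfun P 2%:E.
  by move=> mB; apply: Lfun2_subZ; exact: v2.
split.
  split.
  - by move=> B /Z2/Lfun2_measurable.
  - exact: (jointly_gaussian_subZ c (phi2 _ measurableT) phi2 (cgp_gaussian gv)).
  - move=> B mB; rewrite expectation_subZ; do ?[exact/Lfun2_Lfun1/v2].
    by rewrite !(cgp_centered gv); [rewrite mule0 sube0|exact: phi2|exact: phi2].
move=> B B' mB mB'; rewrite covariance_subZ; do ?[exact: v2].
rewrite !(brownian_bridge_covariance bv); do ?[exact: phi2].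
rewrite !inner_root_density// !inner_root_density_q0 !setTI !setIT.
rewrite probability_setT -/m.
rewrite -[in RHS](fineK (fin_num_measure G _ mB)).
rewrite -[in RHS](fineK (fin_num_measure G _ mB')).
rewrite -[in RHS](fineK (fin_num_measure G _ (measurableI _ _ mB mB'))).
rewrite -?EFinM -?EFinB; congr EFin => /=.
have GE D : measurable D -> \int[F]_(x in D) (l x ^+ 2) = fine (G D).
  by move=> mD; rewrite density.
rewrite /c !GE//; field.
by rewrite subr_eq0 eq_sym.
Qed.

End change_of_measure.

(** * Measures carried by a countable set *)

Section discrete.
Context {R : realType} {d : measure_display} {T : measurableType d}.
Hypothesis m1 : forall x : T, measurable [set x].
Context {X : set T}.
Hypothesis countableX : countable X.

Lemma measurable_subset_countable A : A `<=` X -> measurable A.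
Proof.
move=> AX; apply: (countable_measurable m1).
by apply: sub_countable countableX; exact: subset_card_le.
Qed.

(** Every subset of [X] is measurable, hence so is every function on [X]; the
    indicator erases the arbitrary values outside [X]. *)
Lemma measurable_fun_restr_countable (f : T -> R) :
  measurable_fun setT (fun x => f x * \1_X x).
Proof.
have mX : measurable X by exact: measurable_subset_countable.
have mf : measurable_fun X f.
  by move=> _ Y mY; apply: measurable_subset_countable => x [].
have := (measurable_restrictT f mX).1 mf.
rewrite (_ : f \_ X = fun x => f x * \1_X x)//.
apply/funext => x; rewrite patchE indicE.
by case: (x \in X); rewrite ?mulr1 ?mulr0.
Qed.

(** [G] is carried by [X], so [G B = G (B `&` X)]; then both sides are countably
    additive over the points of [B `&` X] and agree on each point. *)
Lemma discrete_density (F G : probability T R) (f : T -> R) :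
  G X = 1%E -> (forall x, X x -> 0 <= f x) ->
  (forall x, X x -> G [set x] = ((f x)%:E * F [set x])%E) ->
  forall B, measurable B -> G B = (\int[F]_(x in B `&` X) (f x)%:E)%E.
Proof.
move=> GX f0 Gf B mB.
have mX : measurable X by exact: measurable_subset_countable.
have BX x : (B `&` X) x -> X x by case.
have GBX : G B = G (B `&` X).
  have GXC : G (~` X) = 0%E by rewrite probability_setC// GX subee.
  rewrite (measureDI G mB mX) (@subset_measure0 _ _ _ G _ (~` X)) ?add0e//.
  exact: measurableD.
  exact: measurableC.
(* An injection of [X] into [nat] cuts [B `&` X] into pieces with at most one
   point. *)
have /countable_injP[h injh] := countableX.
pose A n := B `&` X `&` h @^-1` [set n].
have mA n : measurable (A n) by apply: measurable_subset_countable => x [[]].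
have AE : \bigcup_n A n = B `&` X.
  by rewrite /A -setI_bigcupr -preimage_bigcup bigcup_imset1 ?image_id
    ?preimage_setT ?setIT.
have tA : trivIset setT A.
  by move=> i j _ _ [x [[_ <-] [_ <-]]].
have mf : measurable_fun (B `&` X) (EFin \o f).
  by move=> _ Y mY; apply: measurable_subset_countable => x [/BX].
rewrite GBX -AE measure_semi_bigcup//; last first.
  by rewrite AE; exact: measurableI.
rewrite ge0_integral_bigcup//=; [|by rewrite AE|]; last first.
  by rewrite AE => x [_ Xx]; rewrite lee_fin f0.
apply: eq_eseriesr => n _.
have [->|/set0P[x Anx]] := eqVneq (A n) set0.
  by rewrite measure0 integral_set0.
have -> : A n = [set x].
  apply/seteqP; split => [y Any|_ ->//].
  apply: injh; rewrite ?inE; [by case: Any => /BX|by case: Anx => /BX|].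
  by case: Any => _ ->; case: Anx => _ ->.
have Xx : X x by case: Anx => /BX.
rewrite Gf//.
transitivity (\int[F]_(y in [set x]) cst (f x)%:E y)%E.
  by rewrite integral_cst.
by apply: eq_integral => y; rewrite inE => ->.
Qed.

End discrete.

(** Points are closed: if [x] and [y] differ in coordinate [j], the matrices
    whose coordinate [j] is not that of [y] form an open set that contains [x]
    and misses [y]. *)
Lemma measurable_set1_borelRd (R : realType) (d : nat) (x : borelRd R d) :
  measurable [set x].
Proof.
rewrite -[X in measurable X]setCK; apply: measurableC.
apply: sub_sigma_algebra.
apply: closed_openC.
apply: accessible_closed_set1 => {x} x y xy.
have [j xyj] : exists j, (x : 'rV[R]_d) ord0 j != (y : 'rV[R]_d) ord0 j.
  apply/existsP; apply: contra_neqT xy => /existsPn E.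
  by apply/rowP => j; apply/eqP; have := E j; rewrite negbK.
exists [set M : 'rV[R]_d | M ord0 j != y ord0 j]; split.
- apply: (open_comp (D := [set r | r != y ord0 j])).
    by move=> M _; exact: coord_continuous.
  exact: open_neq.
- by rewrite inE.
- by rewrite inE /= eqxx.
Qed.

(** * The discrete bridge *)

Theorem corollary5 (R : realType) (d : nat) (X : set (borelRd R d))
    (F G : probability (borelRd R d) R) (p pi_ : borelRd R d -> R)
    (hX : countable X)
    (hF : F X = 1%E) (hG : G X = 1%E)
    (hp : forall x, X x -> F [set x] = (p x)%:E)
    (hp0 : forall x, X x -> 0 < p x)
    (hpi : forall x, X x -> G [set x] = (pi_ x)%:E)
    (hFG : exists2 B, measurable B & G B <> F B)
    (disp : measure_display) (Omega : measurableType disp)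
    (P : probability Omega R)
    (vF : (borelRd R d -> R) -> Omega -> R)
    (hvF : brownian_bridge F P vF) :
  let l := fun x => Num.sqrt (pi_ x / p x) in
  set_brownian_bridge G P (fun B omega =>
    bridge_integral vF (B `&` X) l omega
    - bridge_integral vF X l omega
      * (1 / (1 - \int[F]_(y in X) l y))
      * (\int[G]_(y in B `&` X) 1 - \int[F]_(y in B `&` X) l y)).
Proof.
move=> l.
have m1 := @measurable_set1_borelRd R d.
(* Outside [X] the function [l] is arbitrary, possibly not measurable; [l0] is
   the root density on the whole space. *)
pose l0 y := l y * \1_X y.
have pi0 x : X x -> 0 <= pi_ x by move=> Xx; rewrite -lee_fin -hpi.
have l0sq x : X x -> l0 x ^+ 2 = pi_ x / p x.
  move=> Xx; rewrite /l0 indicE mem_set// mulr1 sqr_sqrtr//.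
  by rewrite divr_ge0 ?pi0// ltW// hp0.
have hG2 B : measurable B -> G B = (\int[F]_(x in B) (l0 x ^+ 2)%:E)%E.
  move=> mB; rewrite (@discrete_density _ _ _ m1 _ hX F G (fun x => l0 x ^+ 2))//.
  - rewrite integral_mkcondr; apply: eq_integral => x _.
    by rewrite patchE /l0 indicE; case: (x \in X); rewrite ?mulr0 ?expr0n.
  - by move=> x _; exact: sqr_ge0.
  - by move=> x Xx; rewrite l0sq// hpi// hp// -EFinM divfK// gt_eqF// hp0.
have ml0 := measurable_fun_restr_countable m1 hX l.
have := bridge_change_of_measure ml0 hG2 hFG hvF.
have lX B : \int[F]_(y in B `&` X) l y = \int[F]_(y in B) l0 y.
  rewrite Rintegral_mkcondr; apply: eq_Rintegral => y _.
  by rewrite patchE /l0 indicE; case: (y \in X); rewrite ?mulr1 ?mulr0.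
have vX B : bridge_integral vF (B `&` X) l = bridge_integral vF B l0.
  congr vF; apply/funext => y.
  by rewrite /l0 !indicE in_setI -mulrA -natrM mulnb andbC.
have GX B : \int[G]_(y in B `&` X) 1 = \int[F]_(x in B) (l0 x ^+ 2).
  have mBX : measurable (B `&` X).
    by apply: (measurable_subset_countable m1 hX) => x [].
  rewrite Rintegral_cst//= mul1r hG2// -[LHS]/(\int[F]_(x in _) _).
  rewrite Rintegral_mkcondr; apply: eq_Rintegral => x _.
  by rewrite patchE /l0 indicE; case: (x \in X); rewrite ?mulr0 ?expr0n.
congr (set_brownian_bridge G P _); apply/funext => B; apply/funext => t.
by rewrite vX lX GX -(vX setT) -(lX setT) !setTI.
Qed.
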